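(* Let $\omega_1(n),\omega_2(n)\to+\infty$. If \[\frac{\log(n)+\log(\log(n))+\omega_1(n)}{n}<p<1-\frac{\log(n)+\log(\log(n))+\omega_2(n)}{n},\] then a.a.s. $\Gamma\in G(n,p)$ has no domination pairs.
   Context: $G(n,p)$ is the Erdős–Rényi random graph on $n$ vertices with each edge present independently with probability $p=p(n)$; a.a.s. means with probability tending to $1$; $\log$ is natural logarithm. For distinct vertices $a,b$, $(a,b)$ is a domination pair if every vertex adjacent to $b$ is adjacent to or equal to $a$. *)

(* Defs.v *)
From HB Require Import structures.
From mathcomp Require Import all_boot all_order all_algebra.
From mathcomp Require Import all_classical all_reals all_analysis.
Set Implicit Arguments. Unset Strict Implicit. Unset Printing Implicit Defensive.
Import Order.TTheory GRing.Theory Num.Theory.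
Local Open Scope ring_scope.

(* Possible edges of a simple graph on vertex set 'I_n: the 2-subsets. *)
Definition pairs (n : nat) : {set {set 'I_n}} := [set e : {set 'I_n} | #|e| == 2%N].

(* A simple graph on 'I_n is an edge set E \subset pairs n. *)
Definition adj (n : nat) (E : {set {set 'I_n}}) (u v : 'I_n) : bool :=
  (u != v) && ([set u; v] \in E).

Definition domination_pair (n : nat) (E : {set {set 'I_n}}) (a b : 'I_n) : bool :=
  (a != b) && [forall v, adj E b v ==> (adj E a v || (v == a))].

Definition has_no_domination_pair (n : nat) (E : {set {set 'I_n}}) : bool :=
  [forall a, forall b, ~~ domination_pair E a b].

Definition Gnp_prob (R : realType) (n : nat) (p : R) (P : {set {set 'I_n}} -> bool) : R :=
  \sum_(E in powerset (pairs n) | P E) p ^+ #|E| * (1 - p) ^+ (#|pairs n| - #|E|).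

(* Main.v *)
(* Write q = 1 - p.  Complementing a graph swaps the roles in a domination pair,
   so one may assume p <= 1/2.  If (a, b) is a domination pair then either b has
   degree at most 1, or N(b) has at least 2 elements and N(b) \ {a} is contained
   in N(a).  The number of vertices of degree at most 1 has expectation at most
   n (1 + n p) q^(n-2), which tends to 0 exactly because n p exceeds
   log n + log log n by a term tending to infinity.  Summing over all possible
   values of N(b), the second case has probability at most
   6 (n p)^2 (1 - p/2)^(n-2), which tends to 0 as soon as n p does to infinity. *)
Require Import Defs.
From HB Require Import structures.
From mathcomp Require Import all_boot all_order all_algebra.
From mathcomp Require Import all_classical all_reals all_analysis.
From mathcomp Require Import ring lra.
From mathcomp.boot Require Import fintype finset.
Import Order.TTheory GRing.Theory Num.Theory.
Set Implicit Arguments. Unset Strict Implicit. Unset Printing Implicit Defensive.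
Local Open Scope ring_scope.

(** * Cylinder events and elementary rules for the random graph measure *)

(** The constraints are imposed edge by edge, so by distributivity the sum over [E] becomes a
    product with one factor for each [e]. *)
Lemma Gnp_cylinder (R : realType) (n : nat) (p : R) (S T : {set {set 'I_n}}) :
  S \subset pairs n -> T \subset pairs n -> [disjoint S & T] ->
  Gnp_prob p (fun E => (S \subset E) && [disjoint T & E]) =
    p ^+ #|S| * (1 - p) ^+ #|T|.
Proof.
move=> sS sT dST; rewrite /Gnp_prob.
(* [F e] and [G e] are the weights of [e] lying in [E] or not. Their zeros force [E] to lie inside
   [pairs n], contain [S] and miss [T]; the sum [F e + G e] is [p] on [S], [1 - p] on [T] and [1]
   elsewhere. *)
pose F e : R := if (e \in pairs n) && (e \notin T) then p else 0.
pose G e : R := if e \in pairs n then if e \in S then 0 else 1 - p else 1.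
transitivity (\sum_(E : {set {set 'I_n}}) \prod_e (if e \in E then F e else G e)).
  rewrite big_mkcond; apply: eq_bigr => E _; rewrite powersetE.
  case: ifPn => [/andP[sE /andP[sSE dTE]]|].
    have -> : (#|pairs n| - #|E|)%N = #|pairs n :\: E|.
      by rewrite cardsD (setIidPr sE).
    rewrite (bigID (mem E)) /=; congr (_ * _).
      rewrite -prodr_const; apply: eq_bigr => e eE.
      by rewrite eE /F (subsetP sE) // (disjointFl dTE).
    rewrite -prodr_const big_mkcond [RHS]big_mkcond; apply: eq_bigr => e _ /=.
    rewrite in_setD; case: (boolP (e \in E)) => //= eE; rewrite /G; case: ifP => // _.
    by rewrite (contraNF (fintype.subsetP sSE e)).
  rewrite !negb_and => /or3P[/subsetPn[e eE eP]|/subsetPn[e eS eE]|].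
  - by rewrite (bigD1 e) //= eE /F (negPf eP) mul0r.
  - by rewrite (bigD1 e) //= (negPf eE) /G (subsetP sS) // eS mul0r.
  - case/pred0Pn => e /andP[/= eT eE].
    by rewrite (bigD1 e) //= eE /F eT andbF mul0r.
rewrite -(bigA_distr _ _ F G) -!prodr_const /=.
rewrite [X in X * _]big_mkcond [X in _ * X]big_mkcond -big_split /=.
apply: eq_bigr => e _; rewrite /F /G.
have [eS|eS] := boolP (e \in S).
  by rewrite (subsetP sS) // (disjointFr dST eS) /= addr0 mulr1.
have [eT|eT] := boolP (e \in T); first by rewrite (subsetP sT) //= add0r mul1r.
case: (e \in pairs n); rewrite /= ?add0r mulr1; last by [].
by rewrite addrC subrK.
Qed.

Lemma Gnp_eq (R : realType) (n : nat) (p : R) (P Q : {set {set 'I_n}} -> bool) :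
  P =1 Q -> Gnp_prob p P = Gnp_prob p Q.
Proof. by move=> PQ; apply: eq_bigl => E; rewrite PQ. Qed.

Lemma Gnp_total (R : realType) (n : nat) (p : R) :
  Gnp_prob p (fun _ : {set {set 'I_n}} => true) = 1.
Proof.
have := @Gnp_cylinder R n p finset.set0 finset.set0 (sub0set _) (sub0set _).
rewrite -setI_eq0 set0I eqxx cards0 !expr0 mulr1 => /(_ isT) <-.
by apply: Gnp_eq => E; rewrite sub0set -setI_eq0 set0I eqxx.
Qed.

Lemma Gnp_not (R : realType) (n : nat) (p : R) (P : {set {set 'I_n}} -> bool) :
  Gnp_prob p P = 1 - Gnp_prob p (fun E => ~~ P E).
Proof.
apply/eqP; rewrite eq_sym subr_eq -(Gnp_total n p) /Gnp_prob; apply/eqP.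
by rewrite (bigID P) /=; congr (_ + _); apply: eq_bigl => E; rewrite andbT.
Qed.

Lemma Gnp_ge0 (R : realType) (n : nat) (p : R) (P : {set {set 'I_n}} -> bool) :
  0 <= p <= 1 -> 0 <= Gnp_prob p P.
Proof.
move=> /andP[p0 p1]; apply: sumr_ge0 => E _.
by rewrite mulr_ge0 ?exprn_ge0 ?subr_ge0.
Qed.

Lemma Gnp_union (R : realType) (n : nat) (p : R) (I : finType) (C : pred I)
    (Q : I -> {set {set 'I_n}} -> bool) (P : {set {set 'I_n}} -> bool) :
  0 <= p <= 1 -> (forall E, P E -> exists2 i, C i & Q i E) ->
  Gnp_prob p P <= \sum_(i | C i) Gnp_prob p (Q i).
Proof.
move=> /andP[p0 p1] PQ; rewrite /Gnp_prob.
under [leRHS]eq_bigr do rewrite /Gnp_prob big_mkcondr.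
rewrite exchange_big /= big_mkcondr; apply: ler_sum => E _.
have w0 : 0 <= p ^+ #|E| * (1 - p) ^+ (#|pairs n| - #|E|).
  by rewrite mulr_ge0 ?exprn_ge0 ?subr_ge0.
case: ifP => [/PQ[i Ci QiE]|_]; last by apply: sumr_ge0 => i _; case: ifP.
by rewrite (bigD1 i) //= QiE lerDl; apply: sumr_ge0 => j _; case: ifP.
Qed.

(** * Passing to the complement graph *)

(** Complementation inside [pairs n] is an involution that exchanges the exponents of [p] and
    [1 - p]. *)
Lemma Gnp_compl (R : realType) (n : nat) (p : R) (P : {set {set 'I_n}} -> bool) :
  Gnp_prob (1 - p) P = Gnp_prob p (fun E => P (pairs n :\: E)).
Proof.
rewrite /Gnp_prob.
have DK (E : {set {set 'I_n}}) : E \subset pairs n -> pairs n :\: (pairs n :\: E) = E.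
  by move=> sE; rewrite setDDr setDv set0U (setIidPr sE).
rewrite (reindex_onto (fun E => pairs n :\: E) (fun E => pairs n :\: E)) /=; last first.
  by move=> E /andP[]; rewrite powersetE => sE _; apply: DK.
apply: eq_big => E; rewrite !powersetE.
  rewrite subsetDl /=; have [sE|nsE] := boolP (E \subset pairs n).
    by rewrite DK // eqxx andbT.
  apply/negbTE; rewrite negb_and; apply/orP; right.
  by apply: contraNN nsE => /eqP <-; rewrite subsetDl.
move=> /andP[_ /eqP sE]; have {}sE : E \subset pairs n by rewrite -sE subsetDl.
rewrite cardsD (setIidPr sE) subKn ?subset_leq_card //.
by rewrite subKr mulrC.
Qed.

Lemma pair_in_pairs (n : nat) (u v : 'I_n) : ([set u; v] \in pairs n) = (u != v).
Proof. by rewrite inE cards2; case: (u != v). Qed.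

Lemma adj_compl (n : nat) (E : {set {set 'I_n}}) (u v : 'I_n) :
  adj (pairs n :\: E) u v = (u != v) && ~~ adj E u v.
Proof. by rewrite /adj in_setD pair_in_pairs; case: (u != v); rewrite /= ?andbT ?andbF. Qed.

Lemma adjC (n : nat) (E : {set {set 'I_n}}) (u v : 'I_n) : adj E u v = adj E v u.
Proof. by rewrite /adj eq_sym setUC. Qed.

(** For [v] other than [a] and [b] the two conditions are contrapositives of each other; at [v = a]
    and [v = b] both hold trivially. *)
Lemma domination_pair_compl (n : nat) (E : {set {set 'I_n}}) (a b : 'I_n) :
  domination_pair (pairs n :\: E) a b = domination_pair E b a.
Proof.
rewrite /domination_pair eq_sym; congr (_ && _); apply: eq_forallb => v.
rewrite !adj_compl (eq_sym v a) (eq_sym v b).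
have adjvv F : adj F v v = false by rewrite /adj eqxx.
have [->|_] := eqVneq b v; first by rewrite orbT implybT.
have [->|_] := eqVneq a v; first by rewrite adjvv orbT implybT.
by rewrite !orbF; case: (adj E a v); case: (adj E b v).
Qed.

Lemma has_no_domination_pair_compl (n : nat) (E : {set {set 'I_n}}) :
  has_no_domination_pair (pairs n :\: E) = has_no_domination_pair E.
Proof.
apply/'forall_forallP/'forall_forallP => H a b.
  by rewrite -domination_pair_compl.
by rewrite domination_pair_compl.
Qed.

Lemma Gnp_no_domination_pair_compl (R : realType) (n : nat) (p : R) :
  Gnp_prob (1 - p) (@has_no_domination_pair n) = Gnp_prob p (@has_no_domination_pair n).
Proof. by rewrite Gnp_compl; apply: Gnp_eq => E; apply: has_no_domination_pair_compl. Qed.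

(** * Neighbourhoods as cylinder events *)

Definition nbhd (n : nat) (E : {set {set 'I_n}}) (b : 'I_n) : {set 'I_n} :=
  [set v | adj E b v].

(** These are genuine edges only when [b \notin N], since [[set b; b]] is a singleton. *)
Definition star (n : nat) (b : 'I_n) (N : {set 'I_n}) : {set {set 'I_n}} :=
  [set [set b; v] | v in N].

Lemma set2_inj (T : finType) (b : T) : injective (fun v => [set b; v]).
Proof.
move=> v w eq_vw; have := set22 b v; rewrite eq_vw => /set2P[vb|//].
by have := set22 b w; rewrite -eq_vw vb => /set2P[->|->].
Qed.

Lemma card_star (n : nat) (b : 'I_n) (N : {set 'I_n}) : #|star b N| = #|N|.
Proof. by rewrite card_imset //; apply: set2_inj. Qed.

Lemma star_pairs (n : nat) (b : 'I_n) (N : {set 'I_n}) :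
  b \notin N -> star b N \subset pairs n.
Proof.
move=> bN; apply/subsetP => e /imsetP[v vN ->]; rewrite pair_in_pairs.
by apply: contraNneq bN => ->.
Qed.

Lemma mem_star (n : nat) (a b v : 'I_n) (N : {set 'I_n}) :
  ([set a; v] \in star b N) = (a == b) && (v \in N) || (v == b) && (a \in N).
Proof.
apply/imsetP/idP => [[w wN e]|].
  have := set21 a v; rewrite e => /set2P[ab|aw].
    by move: e; rewrite ab => /set2_inj ->; rewrite eqxx wN.
  by move: e; rewrite setUC aw setUC [RHS]setUC => /set2_inj ->; rewrite eqxx wN orbT.
case/orP=> /andP[/eqP -> h]; first by exists v.
by exists a; rewrite // setUC.
Qed.

Lemma disjoint_starP (n : nat) (b : 'I_n) (N : {set 'I_n}) (S : {set {set 'I_n}}) :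
  reflect (forall v, v \in N -> [set b; v] \notin S) [disjoint star b N & S].
Proof.
apply: (iffP idP) => [d v vN|H].
  by rewrite (disjointFr d) //; apply: imset_f.
rewrite -setI_eq0; apply/eqP/setP => e; rewrite !inE; apply/negbTE/negP.
by case/andP => /imsetP[v vN ->]; apply/negP/H.
Qed.

Lemma star_subP (n : nat) (b : 'I_n) (N : {set 'I_n}) (S : {set {set 'I_n}}) :
  reflect (forall v, v \in N -> [set b; v] \in S) (star b N \subset S).
Proof.
apply: (iffP subsetP) => [H v vN|H e /imsetP[v vN ->]]; last exact: H.
by apply/H/imset_f.
Qed.

(** Prescribing the neighbourhood decides every edge at [b], which is what [Gnp_cylinder] can
    evaluate. The vertex [b] is left out of the absent star because a loop is not a possible
    edge. *)
Lemma nbhd_cylinder (n : nat) (E : {set {set 'I_n}}) (b : 'I_n) (N : {set 'I_n}) :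
  b \notin N ->
  (nbhd E b == N) = (star b N \subset E) && [disjoint star b (~: (b |: N)) & E].
Proof.
move=> bN; apply/eqP/andP => [<-|[/star_subP sN /disjoint_starP dN]].
  split; first by apply/star_subP => v; rewrite inE => /andP[].
  apply/disjoint_starP => v; rewrite !inE negb_or /adj eq_sym.
  by case: eqVneq => //=.
apply/setP => v; rewrite inE /adj; have [vN|vN] := boolP (v \in N).
  by rewrite sN // andbT; apply: contraNneq bN => ->.
have [//|bv] := eqVneq b v; apply/negbTE/dN.
by rewrite !inE negb_or vN eq_sym bv.
Qed.

Lemma Gnp_nbhd (R : realType) (n : nat) (p : R) (b : 'I_n) (N : {set 'I_n}) :
  b \notin N ->
  Gnp_prob p (fun E => nbhd E b == N) = p ^+ #|N| * (1 - p) ^+ #|~: (b |: N)|.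
Proof.
move=> bN; rewrite (Gnp_eq _ (fun E => nbhd_cylinder E bN)) Gnp_cylinder ?card_star //.
- exact: star_pairs.
- by apply: star_pairs; rewrite !inE eqxx.
- by apply/disjoint_starP => v vN; rewrite mem_star !in_setC !in_setU1 eqxx vN orbT /= andbF.
Qed.

(** Since [a != b] and [b \notin N], no edge from [a] to [N :\ a] is an edge at [b], so domination
    costs [#|N :\ a|] further independent edges. Removing [a] reflects that a neighbour of [b] may
    be [a] itself. *)
Lemma Gnp_nbhd_dominated (R : realType) (n : nat) (p : R) (a b : 'I_n) (N : {set 'I_n}) :
  a != b -> b \notin N ->
  Gnp_prob p (fun E => (nbhd E b == N) && (N :\ a \subset nbhd E a)) =
    p ^+ (#|N| + #|N :\ a|) * (1 - p) ^+ #|~: (b |: N)|.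
Proof.
move=> ab bN.
have dS : [disjoint star a (N :\ a) & star b N].
  apply/disjoint_starP => v /setD1P[va vN]; rewrite mem_star (negPf ab) /=.
  by apply: contraNN bN => /andP[/eqP <-].
have -> : (#|N| + #|N :\ a| = #|star b N :|: star a (N :\ a)|)%N.
  by rewrite cardsU !card_star setIC disjoint_setI0 // cards0 subn0.
rewrite -(card_star b (~: _)) -Gnp_cylinder.
- apply: Gnp_eq => E; rewrite nbhd_cylinder // subUset andbAC; congr (_ && _ && _).
  apply/subsetP/star_subP => H v vN; last by rewrite inE /adj H // andbT eq_sym; case/setD1P: vN.
  by have := H v vN; rewrite inE => /andP[].
- rewrite subUset !star_pairs // !inE ?eqxx //.
- by apply: star_pairs; rewrite !inE eqxx.
- rewrite disjoint_sym; apply/disjoint_starP => v; rewrite !inE negb_or => /andP[vb vN].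
  by rewrite !mem_star eqxx (eq_sym b a) !inE (negPf ab) (negPf vN) (negPf bN) !andbF.
Qed.

(** * Union bounds for the two kinds of domination pair *)

Lemma Gnp_or (R : realType) (n : nat) (p : R) (P Q S : {set {set 'I_n}} -> bool) :
  0 <= p <= 1 -> (forall E, P E -> Q E || S E) ->
  Gnp_prob p P <= Gnp_prob p Q + Gnp_prob p S.
Proof.
move=> p01 PQS.
have := @Gnp_union R n p bool xpredT (fun c => if c then Q else S) P p01.
rewrite big_bool; apply=> E /PQS /orP[QE|SE]; first by exists true.
by exists false.
Qed.

Lemma nbhd_irrefl (n : nat) (E : {set {set 'I_n}}) (b : 'I_n) : b \notin nbhd E b.
Proof. by rewrite inE /adj eqxx. Qed.

(** The empty neighbourhood has probability [(1 - p) ^+ m.+1], and each of the [m.+1] singletons has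
    [p * (1 - p) ^+ m]; both are rounded up to share the factor [(1 - p) ^+ m]. *)
Lemma Gnp_nbhd_le1 (R : realType) (m : nat) (p : R) (b : 'I_m.+2) :
  0 <= p <= 1 ->
  Gnp_prob p (fun E => #|nbhd E b| <= 1)%N <= (1 + m.+2%:R * p) * (1 - p) ^+ m.
Proof.
move=> p01; have /andP[p0 p1] := p01.
apply: (le_trans (@Gnp_or _ _ _ _ (fun E => nbhd E b == finset.set0)
  (fun E => [exists v, (v != b) && (nbhd E b == [set v]%SET)]) p01 _)).
  move=> E; case: ltngtP => // [h _|/eqP/cards1P[v Ev] _].
    by rewrite -cards_eq0 -leqn0 -ltnS h.
  apply/orP; right; apply/existsP; exists v; rewrite Ev eqxx andbT.
  by apply: contraNneq (nbhd_irrefl E b) => vb; rewrite Ev vb set11.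
have cD1 : (#|~: [set b]| = m.+1)%N by rewrite cardsC1 card_ord.
rewrite mulrDl mul1r; apply: lerD.
  rewrite Gnp_nbhd ?inE // cards0 expr0 mul1r finset.setU0 cD1.
  by rewrite exprS ler_piMl ?exprn_ge0 ?subr_ge0 // gerBl.
apply: (le_trans (@Gnp_union _ _ _ _ (fun v => v != b)
  (fun v E => nbhd E b == [set v]%SET) _ p01 _)).
  by move=> E /existsP[v /andP[vb Ev]]; exists v.
have <- : \sum_(v < m.+2) p * (1 - p) ^+ m = m.+2%:R * p * (1 - p) ^+ m.
  by rewrite sumr_const card_ord -mulrA mulr_natl.
rewrite big_mkcond; apply: ler_sum => v _; case: ifPn => [vb|_]; last first.
  by rewrite mulr_ge0 ?exprn_ge0 ?subr_ge0.
rewrite Gnp_nbhd ?inE 1?eq_sym // cards1 expr1.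
suff -> : (#|~: [set b; v]| = m)%N by [].
by apply/eqP; rewrite -(eqn_add2l #|[set b; v]|) cardsC card_ord cards2 (eq_sym b v) vb.
Qed.

(* Each summand with #|N| >= 2 is multiplied by (2 p)^(2 - #|N|) >= 1; the sum
   over all N then factors over the vertices. *)
Lemma Gnp_dominated_nbhd_gt1 (R : realType) (m : nat) (p : R) (a b : 'I_m.+2) :
  0 <= p <= 2^-1 -> a != b ->
  Gnp_prob p (fun E => (1 < #|nbhd E b|)%N && (nbhd E b :\ a \subset nbhd E a)) <=
    6 * p ^+ 2 * (1 - p / 2) ^+ m.
Proof.
move=> /andP[p0 p2] ab.
have p1 : p <= 1 by lra.
have q0 : 0 <= 1 - p by lra.
apply: (le_trans (@Gnp_union _ _ _ _ (fun N : {set 'I_m.+2} => (b \notin N) && (1 < #|N|)%N)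
  (fun N E => (nbhd E b == N) && (N :\ a \subset nbhd E a)) _ _ _)); first by rewrite p0 p1.
  by move=> E /andP[c s]; exists (nbhd E b); rewrite ?eqxx ?s ?c ?nbhd_irrefl.
(* Weights of [v] lying in [N] or not, after a factor [2^-1] per element of [N] is extracted. The
   zero at [b] keeps [b] out of [N]; at [a] there is no factor [p], as no edge from [a] to itself is
   required. *)
pose F v : R := if v == b then 0 else if v == a then 2^-1 else p / 2.
pose G v : R := if v == b then 1 else 1 - p.
have F0 v : 0 <= F v by rewrite /F; case: ifP => // _; case: ifP => _; lra.
have G0 v : 0 <= G v by rewrite /G; case: ifP.
apply: (@le_trans _ _ (\sum_(N : {set 'I_m.+2})
    (2 * p) ^+ 2 * \prod_v (if v \in N then F v else G v))).
  rewrite big_mkcond; apply: ler_sum => N _; case: ifPn => [/andP[bN cN]|_]; last first.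
    by rewrite mulr_ge0 ?sqr_ge0 //; apply: prodr_ge0 => v _; case: ifP.
  rewrite Gnp_nbhd_dominated //.
  have -> : \prod_v (if v \in N then F v else G v) =
      2^-1 ^+ #|N| * p ^+ #|N :\ a| * (1 - p) ^+ #|~: (b |: N)|.
    rewrite (bigID (mem N)) /=; congr (_ * _).
      rewrite -!prodr_const [X in _ * X](_ : _ = \prod_(v in N) if v == a then 1 else p).
        rewrite -big_split; apply: eq_bigr => v vN; rewrite vN /F.
        have /negPf -> : v != b by apply: contraNneq bN => <-.
        by case: (v == a); rewrite /= ?mulr1 // mulrC.
      rewrite big_mkcond [RHS]big_mkcond; apply: eq_bigr => v _.
      by rewrite in_setD1; case: (v \in N); case: (v == a).
    rewrite -prodr_const big_mkcond [RHS]big_mkcond; apply: eq_bigr => v _.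
    rewrite in_setC in_setU1 negb_or /G.
    by case: (v \in N); case: (v == b).
  rewrite exprD !mulrA; do 2 (apply: ler_wpM2r; first by rewrite exprn_ge0).
  rewrite -(subnKC cN) !exprD.
  have -> : (2 * p) ^+ 2 * (2^-1 ^+ 2 * 2^-1 ^+ (#|N| - 2)) = p ^+ 2 * 2^-1 ^+ (#|N| - 2) :> R.
    by rewrite mulrA; congr (_ * _); field.
  by rewrite ler_wpM2l ?sqr_ge0 // lerXn2r ?nnegrE ?invr_ge0.
(* The vertex [b] contributes [1], [a] contributes [3 / 2 - p], and each of the other [m] vertices
   [1 - p / 2]. The constant [6] bounds [4 * (3 / 2 - p)]. *)
rewrite -mulr_sumr -(bigA_distr _ _ F G) (bigD1 b) //= (bigD1 a) //=.
rewrite /F /G eqxx (negPf ab) eqxx add0r mul1r.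
rewrite (eq_bigr (fun _ => 1 - p / 2)) => [|v /andP[/negPf -> /negPf ->]]; last by field.
rewrite prodr_const.
have -> : #|[pred v | (v != b) && (v != a)]| = m.
  transitivity #|~: [set b; a]|; first by apply: eq_card => v; rewrite !inE negb_or.
  by apply/eqP; rewrite -(eqn_add2l #|[set b; a]|) cardsC card_ord cards2 (eq_sym b a) ab.
rewrite !mulrA ler_wpM2r ?exprn_ge0 //; first lra.
by have := sqr_ge0 p; nra.
Qed.

(** The first term sums the low degree bound over all [b]; the second sums the other bound over
    ordered pairs, counted as [m.+2 ^ 2]. *)
Lemma Gnp_domination_pair_le (R : realType) (m : nat) (p : R) :
  0 <= p <= 2^-1 ->
  1 - Gnp_prob p (@has_no_domination_pair m.+2) <=
    m.+2%:R * (1 + m.+2%:R * p) * (1 - p) ^+ m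
    + 6 * (m.+2%:R * p) ^+ 2 * (1 - p / 2) ^+ m.
Proof.
move=> p02; have /andP[p0 p2] := p02.
have p01 : 0 <= p <= 1 by lra.
rewrite Gnp_not opprB addrC subrK.
apply: (le_trans (@Gnp_or _ _ _ _ (fun E => [exists b, #|nbhd E b| <= 1]%N)
  (fun E => [exists ab : 'I_m.+2 * 'I_m.+2, (ab.1 != ab.2) &&
     ((1 < #|nbhd E ab.2|)%N && (nbhd E ab.2 :\ ab.1 \subset nbhd E ab.1))]) p01 _)).
  move=> E; rewrite negb_forall => /existsP[a]; rewrite negb_forall => /existsP[b].
  rewrite negbK => /andP[ab /forallP dom].
  have [low|high] := leqP #|nbhd E b| 1%N.
    by apply/orP; left; apply/existsP; exists b.
  apply/orP; right; apply/existsP; exists (a, b); rewrite /= ab high /=.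
  apply/fintype.subsetP => v /setD1P[va]; rewrite !inE => bv.
  by have := dom v; rewrite bv (negPf va) orbF.
apply: lerD.
  apply: (le_trans (@Gnp_union _ _ _ _ xpredT (fun b E => #|nbhd E b| <= 1)%N _ p01 _)).
    by move=> E /existsP[b Eb]; exists b.
  apply: (le_trans (ler_sum _ (fun b _ => Gnp_nbhd_le1 b p01))).
  by rewrite sumr_const card_ord -[leLHS]mulr_natl mulrA.
apply: (le_trans (@Gnp_union _ _ _ _ (fun ab : 'I_m.+2 * 'I_m.+2 => ab.1 != ab.2)
  (fun ab E => (1 < #|nbhd E ab.2|)%N && (nbhd E ab.2 :\ ab.1 \subset nbhd E ab.1)) _ p01 _)).
  by move=> E /existsP[ab /andP[? ?]]; exists ab.
apply: (le_trans (ler_sum _ (fun ab h => Gnp_dominated_nbhd_gt1 p02 h))).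
have B0 : 0 <= 6 * p ^+ 2 * (1 - p / 2) ^+ m.
  by rewrite !mulr_ge0 ?sqr_ge0 ?exprn_ge0 //; lra.
apply: (@le_trans _ _ (\sum_(ab : 'I_m.+2 * 'I_m.+2) 6 * p ^+ 2 * (1 - p / 2) ^+ m)).
  by rewrite big_mkcond; apply: ler_sum => ab _; case: ifP.
by rewrite sumr_const card_prod card_ord -[leLHS]mulr_natl natrM [leRHS](_ : _ =
  m.+2%:R * m.+2%:R * (6 * p ^+ 2 * (1 - p / 2) ^+ m)) //; ring.
Qed.

(** * Exponential tail estimates *)

Lemma pow_le_expR (R : realType) (m : nat) (p : R) :
  p <= 1 -> (1 - p) ^+ m <= expR (- (m%:R * p)).
Proof.
move=> p1; rewrite -mulrN mulrC expRM_natr.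
by apply: lerXn2r; rewrite ?nnegrE ?subr_ge0 ?expR_ge0 //; apply: expR_ge1Dx.
Qed.

(** Here [l] stands for [ln n] and [x] for [n * p]. With [x = l + ln l + w + y], the left side is
    [(1 + x) / (l * expR w * expR y)]: the summand [ln l] supplies the [l] that offsets the growth
    of [1 + x]. *)
Lemma low_degree_tail (R : realType) (l w x : R) :
  1 <= l -> 1 <= w -> l + ln l + w <= x ->
  expR l * (1 + x) * expR (- x) <= 8 / w.
Proof.
move=> l1 w1 lx; have l0 : 0 < l by lra.
have w0 : 0 < w by lra.
set y := x - (l + ln l + w); have y0 : 0 <= y by rewrite /y; lra.
have -> : expR (- x) = expR (- l) * l^-1 * (expR w)^-1 * (expR y)^-1.
  rewrite -[X in _ * X^-1 * _ * _](lnK l0) -!expRN -!expRD; congr expR; rewrite /y; ring.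
have -> : expR l * (1 + x) * (expR (- l) * l^-1 * (expR w)^-1 * (expR y)^-1) =
    (1 + x) / (l * expR w * expR y).
  have e1 := expR_gt0 l; have e2 := expR_gt0 w; have e3 := expR_gt0 y.
  rewrite expRN; field; by rewrite !gt_eqF.
(* The quadratic term is there to absorb [(3 + w) * w], through [(3 + w) * w <= 8 * expR w]. *)
have ew : 1 + w ^+ 2 / 2 <= expR w by have := @expR_ge1Dxn R w 1 (ltW w0).
have ey := expR_ge1Dx y.
have lnl : ln l <= l - 1 by have := @le_ln1Dx R (l - 1); rewrite subrKC; apply; lra.
have ew0 := expR_gt0 w; have ey0 := expR_gt0 y.
rewrite ler_pdivrMr ?mulr_gt0 // mulrAC ler_pdivlMr //.
have x1 : 1 + x <= l * (3 + w) * (1 + y) .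
  have M1 : 2 * l + w <= l * (3 + w) by nra.
  have M2 : y <= l * (3 + w) * y by rewrite ler_peMl //; lra.
  have xE : x = l + ln l + w + y by rewrite /y; ring.
  by rewrite [leRHS]mulrDr mulr1; lra.
apply: (@le_trans _ _ (l * (3 + w) * (1 + y) * w)); first by rewrite ler_wpM2r // ltW.
rewrite mulrAC !mulrA; apply: ler_pM => //.
- by rewrite !mulr_ge0 //; lra.
- by lra.
rewrite -!mulrA [leRHS]mulrCA ler_wpM2l //; first lra.
nra.
Qed.

(** The cubic term of the exponential series gives [1 + x ^+ 3 / 48 <= expR (x / 2)]. *)
Lemma sqr_expR_tail (R : realType) (x : R) :
  0 < x -> x ^+ 2 * expR (- (x / 2)) <= 48 / x.
Proof.
move=> x0; have := @expR_ge1Dxn R (x / 2) 2 _; rewrite /factorial /=.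
move=> /(_ ltac:(lra)) h; rewrite expRN ler_pdivrMr ?expR_gt0 //.
rewrite mulrAC ler_pdivlMr //; move: h; rewrite expr_div_n; lra.
Qed.

(** The factor [expR 1] pays for the exponent [n - 2] in place of [n], as [2 * p <= 1]. The constant
    [288] is [6 * 48]. *)
Lemma Gnp_domination_pair_asymptotic (R : realType) (n : nat) (p w : R) :
  1 <= ln (n%:R : R) -> 1 <= w -> p <= 2^-1 ->
  (ln n%:R + ln (ln n%:R) + w) / n%:R <= p ->
  1 - Gnp_prob p (@has_no_domination_pair n) <=
    expR 1 * (8 / w + 288 / ln n%:R).
Proof.
(* For [n] equal to 0 or 1 the logarithm is 0, by convention in the first case, which contradicts
   [l1]. *)
case: n => [|[|m]] l1 w1 p2; [by rewrite ln0 // in l1; lra|by rewrite ln1 in l1; lra|].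
set l := ln _ in l1 *; set x : R := m.+2%:R * p; have n0 : 0 < m.+2%:R :> R by [].
rewrite ler_pdivrMr // mulrC -/x => lx.
have l0 : 0 < l by lra.
have ln_l0 : 0 <= ln l by rewrite ln_ge0.
have x0 : 0 < x by lra.
have p0 : 0 <= p by rewrite -(pmulr_rge0 _ n0) ltW.
have mE : m%:R = m.+2%:R - 2 :> R by rewrite -[in RHS](addn2 m) natrD addrK.
apply: (le_trans (Gnp_domination_pair_le m _)); first by rewrite p0.
rewrite -/x [leRHS]mulrDr; apply: lerD.
  apply: (@le_trans _ _ (m.+2%:R * (1 + x) * (expR 1 * expR (- x)))).
    apply: ler_wpM2l; first by rewrite mulr_ge0 //; lra.
    apply: (le_trans (pow_le_expR m _)); first lra.
    by rewrite -expRD ler_expR mE mulrBl -/x; lra.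
  rewrite mulrCA; apply: ler_wpM2l; first exact: expR_ge0.
  by have := low_degree_tail l1 w1 lx; rewrite lnK.
apply: (@le_trans _ _ (6 * x ^+ 2 * (expR 1 * expR (- (x / 2))))).
  apply: ler_wpM2l; first by rewrite mulr_ge0 ?sqr_ge0.
  apply: (le_trans (pow_le_expR m _)); first lra.
  by rewrite -expRD ler_expR mE mulrA mulrBl -/x; lra.
rewrite mulrCA; apply: ler_wpM2l; first exact: expR_ge0.
have := sqr_expR_tail x0.
have : 48 / x <= 48 / l.
  by rewrite ler_pM2l // lef_pV2 ?posrE //; lra.
by rewrite -mulrA; lra.
Qed.

(** * Convergence to 1 *)

Local Open Scope classical_set_scope.

Theorem theorem2p13 (R : realType) (omega1 omega2 p : nat -> R) :
  omega1 @ \oo --> +oo ->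
  omega2 @ \oo --> +oo ->
  (\forall n \near \oo,
     (ln n%:R + ln (ln n%:R) + omega1 n) / n%:R < p n /\
     p n < 1 - (ln n%:R + ln (ln n%:R) + omega2 n) / n%:R) ->
  (fun n => Gnp_prob (p n) (@has_no_domination_pair n)) @ \oo --> (1 : R^o).
Proof.
move=> /cvgryPge om1 /cvgryPge om2 hp.
apply/cvgrPdist_le => e e0.
have E0 := expR_gt0 (1 : R).
(* Once [omega1 n], [omega2 n] and [ln n] exceed [A], each of the two error terms is at most
   [e / 2]; the added [1] secures the hypotheses [1 <= w] and [1 <= ln n]. *)
pose A : R := expR 1 * 576 / e + 1.
have A1 : 1 <= A.
  by rewrite lerDr; apply: divr_ge0 (ltW e0); apply: mulr_ge0 (ltW E0) (ler0n _ _).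
have tail (y : R) : A <= y -> expR 1 * (288 / y) <= e / 2.
  move=> Ay; have y0 : 0 < y by lra.
  rewrite mulrA ler_pdivrMr // mulrAC ler_pdivlMr // -ler_pdivrMl //.
  by apply: le_trans Ay; rewrite /A mulrC -[_ * 288 * 2]mulrA -natrM lerDl.
near=> n.
have [h1 h2] : (ln n%:R + ln (ln n%:R) + omega1 n) / n%:R < p n /\
     p n < 1 - (ln n%:R + ln (ln n%:R) + omega2 n) / n%:R by near: n.
have o1 : A <= omega1 n by near: n; apply: om1.
have o2 : A <= omega2 n by near: n; apply: om2.
have lnA : A <= ln (n%:R : R).
  have nA : expR A <= n%:R by near: n; apply: nbhs_infty_ger.
  by rewrite -ler_expR lnK // posrE (lt_le_trans (expR_gt0 A)).
have lln : 0 <= ln (ln (n%:R : R)) by rewrite ln_ge0 //; lra.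
(* Stated for general [r] and [w] so as to serve both [p n] with [omega1 n] and [1 - p n] with
   [omega2 n]. *)
have bound (r w : R) : A <= w -> r <= 2^-1 ->
    (ln n%:R + ln (ln n%:R) + w) / n%:R <= r ->
    1 - Gnp_prob r (@has_no_domination_pair n) <= e.
  move=> Aw r2 wr.
  apply: (le_trans (Gnp_domination_pair_asymptotic _ _ r2 wr)); try lra.
  have tw := tail w Aw; have tl := tail _ lnA; rewrite mulrDr.
  have : expR 1 * (8 / w) <= expR 1 * (288 / w).
    by rewrite ler_wpM2l ?ler_wpM2r ?invr_ge0 ?ler_nat //; lra.
  lra.
have pos w : A <= w -> 0 <= (ln n%:R + ln (ln n%:R) + w) / n%:R.
  by move=> Aw; rewrite mulr_ge0 ?invr_ge0 //; lra.
have p01 : 0 <= p n <= 1 by have := pos _ o1; have := pos _ o2; lra.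
have -> : `|1 - Gnp_prob (p n) (@has_no_domination_pair n)| =
    1 - Gnp_prob (p n) (@has_no_domination_pair n).
  by apply: ger0_norm; rewrite Gnp_not opprB addrC subrK Gnp_ge0.
have [p2|p2] := leP (p n) 2^-1; first by apply: (bound _ (omega1 n)) => //; apply: ltW.
(* For [p n] above one half, the upper bound on [p n] is the required lower bound on [1 - p n]. *)
rewrite -Gnp_no_domination_pair_compl; apply: (bound _ (omega2 n)) => //; lra.
Unshelve. all: by end_near.
Qed.
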